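(* Let $p$ be a prime and let $G$ be a finite $p$-group. Let $m$ and $s$ be positive integers with $m\geq s$, and suppose that $\gamma_{i+s}(G)=\gamma_i(G)^p$ for every $i\geq m$. Then: (a) $\gamma_{i+s+1}(\nu(G))=\gamma_{i+1}(\nu(G))^p$ for every $i>m$; (b) if $p$ is odd, then $\exp(\gamma_{m+1}(\nu(G)))$ divides $\exp(\gamma_m(G))$; (c) if $p=2$ and $\gamma_m(G)$ is powerful, then $\exp(\gamma_{m+1}(\nu(G)))$ divides $\exp(\gamma_m(G))$.
   Context: Conventions: $x^y=y^{-1}xy$ and $[x,y]=x^{-1}y^{-1}xy$. $\gamma_1(H)=H$ and $\gamma_{i+1}(H)=[\gamma_i(H),H]$ is the lower central series. For a group $H$ and $k\ge 1$, $H^{k}$ is the subgroup generated by all $k$-th powers of elements of $H$. $\exp(H)$ is the exponent of $H$. A finite $p$-group $H$ is powerful if $H'\leq H^p$ (for $p>2$) or $H'\leq H^4$ (for $p=2$). For a group $G$, let $\varphi:G\to G^{\varphi}$, $g\mapsto g^{\varphi}$, be an isomorphism onto a copy $G^{\varphi}$ of $G$, and define $\nu(G)$ to be the group generated by $G\cup G^{\varphi}$ (keeping all relations of $G$ and of $G^\varphi$) subject to the additional relations $[g_1,g_2^{\varphi}]^{g_3}=[g_1^{g_3},(g_2^{g_3})^{\varphi}]=[g_1,g_2^{\varphi}]^{g_3^{\varphi}}$ for all $g_1,g_2,g_3\in G$. *)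

(* Defs.v *)
From HB Require Import structures.
From mathcomp Require Import all_boot all_fingroup all_solvable.
From mathcomp Require Import generic_quotient boolp classical_sets.

Set Implicit Arguments.
Unset Strict Implicit.
Unset Printing Implicit Defensive.

Local Open Scope group_scope.
Local Open Scope quotient_scope.

Section Nu.
Variable gT : groupType.

(* The letter inl g stands for the generator g of G, the letter inr g for the *)
(* generator g^phi of the copy of G.                                          *)
Definition nu_word := seq (gT + gT).
Definition inG (g : gT) : nu_word := [:: inl g].
Definition inGphi (g : gT) : nu_word := [:: inr g].

Definition letter_inv (a : gT + gT) : gT + gT :=
  match a with inl g => inl g^-1 | inr g => inr g^-1 end.
Definition word_inv (u : nu_word) : nu_word := rev (map letter_inv u).
Definition word_conj (u v : nu_word) : nu_word := word_inv v ++ u ++ v.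
Definition word_comm (u v : nu_word) : nu_word :=
  word_inv u ++ word_inv v ++ u ++ v.

(* The least congruence on words containing the multiplication tables of G    *)
(* and of its copy and the defining relations of nu(G).  The tables make each *)
(* letter invertible, with inverse given by letter_inv, so that this monoid   *)
(* presentation presents the same object as the group presentation.           *)
Inductive nu_cong : nu_word -> nu_word -> Prop :=
| nu_refl u : nu_cong u u
| nu_sym u v : nu_cong u v -> nu_cong v u
| nu_trans u v w : nu_cong u v -> nu_cong v w -> nu_cong u w
| nu_cat u u' v v' :
    nu_cong u u' -> nu_cong v v' -> nu_cong (u ++ v) (u' ++ v')
| nu_G1 : nu_cong (inG 1) [::]
| nu_GM g h : nu_cong (inG g ++ inG h) (inG (g * h))
| nu_Gphi1 : nu_cong (inGphi 1) [::]
| nu_GphiM g h : nu_cong (inGphi g ++ inGphi h) (inGphi (g * h))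
| nu_relG g1 g2 g3 :
    nu_cong (word_conj (word_comm (inG g1) (inGphi g2)) (inG g3))
            (word_comm (inG (g1 ^ g3)) (inGphi (g2 ^ g3)))
| nu_relGphi g1 g2 g3 :
    nu_cong (word_comm (inG (g1 ^ g3)) (inGphi (g2 ^ g3)))
            (word_conj (word_comm (inG g1) (inGphi g2)) (inGphi g3)).

Definition nu_eqv (u v : nu_word) : bool := `[< nu_cong u v >].

Lemma nu_eqv_refl : reflexive nu_eqv.
Proof. by move=> u; apply/asboolP; apply: nu_refl. Qed.

Lemma nu_eqv_sym : symmetric nu_eqv.
Proof. by move=> u v; apply/asboolP/asboolP; apply: nu_sym. Qed.

Lemma nu_eqv_trans : transitive nu_eqv.
Proof. by move=> v u w /asboolP uv /asboolP vw; apply/asboolP/(nu_trans uv vw). Qed.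

Canonical nu_equiv := EquivRel nu_eqv nu_eqv_refl nu_eqv_sym nu_eqv_trans.

Definition nu := {eq_quot nu_equiv}.
HB.instance Definition _ := Choice.on nu.
HB.instance Definition _ := EqQuotient.on nu.

Lemma nu_congP (u v : nu_word) : reflect (nu_cong u v) (u == v %[mod nu]).
Proof. by rewrite piE; apply: asboolP. Qed.

Definition nu_one : nu := \pi_nu [::].
Definition nu_mul (x y : nu) : nu := \pi_nu (repr x ++ repr y).
Definition nu_inv (x : nu) : nu := \pi_nu (word_inv (repr x)).

Lemma nu_repr (u : nu_word) : nu_cong (repr (\pi_nu u)) u.
Proof. by apply/nu_congP; rewrite reprK. Qed.

Lemma nu_mulE (u v : nu_word) : nu_mul (\pi_nu u) (\pi_nu v) = \pi_nu (u ++ v).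
Proof. by apply/eqP/nu_congP; apply: nu_cat; apply: nu_repr. Qed.

Lemma word_invK : involutive word_inv.
Proof.
move=> u; rewrite /word_inv map_rev revK -map_comp map_id_in //.
by case=> g _ /=; rewrite invgK.
Qed.

Lemma nu_cong_invl (u : nu_word) : nu_cong (word_inv u ++ u) [::].
Proof.
elim: u => [|a u IHu]; first exact: nu_refl.
rewrite /word_inv map_cons rev_cons cat_rcons -cat1s.
rewrite -[a :: u]cat1s (catA [:: letter_inv a]).
apply: nu_trans IHu; apply: nu_cat; first exact: nu_refl.
rewrite -[X in nu_cong _ X]cat0s; apply: nu_cat; last exact: nu_refl.
case: a => g.
  by apply: nu_trans (nu_GM _ _) _; rewrite mulVg; apply: nu_G1.
by apply: nu_trans (nu_GphiM _ _) _; rewrite mulVg; apply: nu_Gphi1.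
Qed.

Lemma nu_mulA : associative nu_mul.
Proof.
elim/quotW=> u; elim/quotW=> v; elim/quotW=> w.
by rewrite (nu_mulE v w) (nu_mulE u v) !nu_mulE catA.
Qed.

Lemma nu_mul1 : left_id nu_one nu_mul.
Proof. by move=> x; rewrite -[x]reprK /nu_one nu_mulE. Qed.

Lemma nu_mulr1 : right_id nu_one nu_mul.
Proof. by move=> x; rewrite -[x]reprK /nu_one nu_mulE cats0. Qed.

Lemma nu_mulV : left_inverse nu_one nu_inv nu_mul.
Proof.
move=> x; rewrite -{2}[x]reprK nu_mulE.
by apply/eqP/nu_congP/nu_cong_invl.
Qed.

Lemma nu_mulrV : right_inverse nu_one nu_inv nu_mul.
Proof.
move=> x; rewrite -{1}[x]reprK nu_mulE -{1}[repr x]word_invK.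
by apply/eqP/nu_congP/nu_cong_invl.
Qed.

HB.instance Definition _ :=
  isGroup.Build nu nu_mulA nu_mul1 nu_mulr1 nu_mulV nu_mulrV.

Lemma nu_ME (u v : nu_word) : \pi_nu (u ++ v) = \pi_nu u * \pi_nu v :> nu.
Proof. by rewrite -nu_mulE. Qed.

Lemma nu_VE (u : nu_word) : \pi_nu (word_inv u) = (\pi_nu u)^-1 :> nu.
Proof.
apply: (mulIg (\pi_nu u)); rewrite mulVg -nu_ME.
by apply/eqP/nu_congP/nu_cong_invl.
Qed.

Definition nu_in (g : gT) : nu := \pi_nu (inG g).
Definition nu_phi (g : gT) : nu := \pi_nu (inGphi g).

Lemma nu_inM : {morph nu_in : g h / g * h}.
Proof. by move=> g h; rewrite -nu_ME; apply/esym/eqP/nu_congP/nu_GM. Qed.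

Lemma nu_phiM : {morph nu_phi : g h / g * h}.
Proof. by move=> g h; rewrite -nu_ME; apply/esym/eqP/nu_congP/nu_GphiM. Qed.

Lemma nu_conjE (u v : nu_word) :
  \pi_nu (word_conj u v) = \pi_nu u ^ \pi_nu v :> nu.
Proof. by rewrite !nu_ME nu_VE. Qed.

Lemma nu_commE (u v : nu_word) :
  \pi_nu (word_comm u v) = [~ \pi_nu u, \pi_nu v] :> nu.
Proof. by rewrite !nu_ME !nu_VE. Qed.

Lemma nu_in_rel g1 g2 g3 :
  [~ nu_in g1, nu_phi g2] ^ nu_in g3
    = [~ nu_in (g1 ^ g3), nu_phi (g2 ^ g3)].
Proof.
by rewrite -!nu_commE -nu_conjE; apply/eqP/nu_congP/nu_relG.
Qed.

Lemma nu_phi_rel g1 g2 g3 :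
  [~ nu_in (g1 ^ g3), nu_phi (g2 ^ g3)]
    = [~ nu_in g1, nu_phi g2] ^ nu_phi g3.
Proof.
by rewrite -!nu_commE -nu_conjE; apply/eqP/nu_congP/nu_relGphi.
Qed.

Lemma nu_universal (K : groupType) (f fphi : gT -> K) :
    {morph f : g h / g * h} -> {morph fphi : g h / g * h} ->
    (forall g1 g2 g3, [~ f g1, fphi g2] ^ f g3
                        = [~ f (g1 ^ g3), fphi (g2 ^ g3)]) ->
    (forall g1 g2 g3, [~ f (g1 ^ g3), fphi (g2 ^ g3)]
                        = [~ f g1, fphi g2] ^ fphi g3) ->
  exists! F : nu -> K, [/\ {morph F : x y / x * y},
    forall g, F (nu_in g) = f g & forall g, F (nu_phi g) = fphi g].
Proof.
move=> fM fphiM rel1 rel2.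
have f1 : f 1 = 1 by apply: (mulIg (f 1)); rewrite -fM !mul1g.
have fphi1 : fphi 1 = 1 by apply: (mulIg (fphi 1)); rewrite -fphiM !mul1g.
have fV g : f g^-1 = (f g)^-1 by apply: (mulIg (f g)); rewrite -fM !mulVg.
have fphiV g : fphi g^-1 = (fphi g)^-1.
  by apply: (mulIg (fphi g)); rewrite -fphiM !mulVg.
pose lt (a : gT + gT) := match a with inl g => f g | inr g => fphi g end.
pose ev (u : nu_word) : K := foldr (fun a x => lt a * x) 1 u.
have evM u v : ev (u ++ v) = ev u * ev v.
  by elim: u => [|a u IHu] /=; rewrite ?mul1g // IHu mulgA.
have ev1 a : ev [:: a] = lt a by rewrite /= mulg1.
have evV u : ev (word_inv u) = (ev u)^-1.
  elim: u => [|a u IHu]; first by rewrite /= invg1.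
  rewrite /word_inv map_cons rev_cons -cats1 evM -/(word_inv u) IHu ev1 /=.
  by rewrite invMg; congr (_ * _); case: a => g /=.
have evC u v : ev (word_comm u v) = [~ ev u, ev v] by rewrite !evM !evV.
have evJ u v : ev (word_conj u v) = ev u ^ ev v by rewrite !evM !evV.
have ev_cong u v : nu_cong u v -> ev u = ev v.
  elim=> {u v} //.
  - by move=> u v w _ -> _ ->.
  - by move=> u u' v v' _ Eu _ Ev; rewrite !evM Eu Ev.
  - by rewrite ev1.
  - by move=> g h; rewrite evM !ev1 /= fM.
  - by rewrite ev1.
  - by move=> g h; rewrite evM !ev1 /= fphiM.
  - by move=> g1 g2 g3; rewrite evJ !evC !ev1 rel1.
  - by move=> g1 g2 g3; rewrite evJ !evC !ev1 rel2.
pose F (x : nu) := ev (repr x).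
have FE u : F (\pi_nu u) = ev u by apply/ev_cong/nu_repr.
exists F; split.
  split=> [x y|g|g]; [| by rewrite /nu_in FE ev1 | by rewrite /nu_phi FE ev1].
  by rewrite -[x]reprK -[y]reprK -nu_ME !FE evM.
move=> F' [F'M F'f F'fphi]; apply/funext; elim/quotW=> u; rewrite FE.
elim: u => [|a u IHu] /=.
  by apply: (mulIg (F' (\pi_nu [::]))); rewrite mul1g -F'M -nu_ME.
by rewrite -cat1s nu_ME F'M -IHu; case: a => g /=; rewrite -?F'f -?F'fphi.
Qed.

End Nu.

Section Subgroups.
Variable N : groupType.
Local Open Scope classical_set_scope.

Definition is_subgroup (H : set N) : Prop :=
  H 1 /\ forall x y, H x -> H y -> H (x * y^-1).

Definition subgroup_gen (A : set N) : set N := smallest is_subgroup A.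

Definition commutator_sub (A B : set N) : set N :=
  subgroup_gen [set z | exists x y, [/\ A x, B y & z = [~ x, y]]].

Definition power_sub (k : nat) (H : set N) : set N :=
  subgroup_gen [set z | exists2 x, H x & z = x ^+ k].

(* Indexed from 1, as lower_central_at; gamma_series 0 is also the whole      *)
(* group.                                                                     *)
Definition gamma_series (i : nat) : set N :=
  iter i.-1 (fun B => commutator_sub B setT) setT.

Definition has_exponent (H : set N) (e : nat) : Prop :=
  (0 < e)%N /\ forall x, H x -> x ^+ e = 1.

(* The value 0 stands for an infinite exponent; note that 0 divides no        *)
(* positive number.                                                           *)
Definition exponent_set (H : set N) : nat :=
  if pselect (exists e, `[< has_exponent H e >]) is left exP
  then ex_minn exP else 0.

End Subgroups.

Arguments gamma_series N i : clear implicits.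

Definition power_subgroup (gT : finGroupType) (k : nat) (H : {set gT}) :=
  <<[set x ^+ k | x in H]>>.

Definition powerful (gT : finGroupType) (p : nat) (H : {set gT}) : bool :=
  p.-group H &&
    ([~: H, H] \subset power_subgroup (if p == 2 then 4 else p) H).

(* Main.v *)
Require Import Defs.
From HB Require Import structures.
From mathcomp Require Import all_boot all_fingroup all_solvable.
From mathcomp Require Import boolp classical_sets zify.

Set Implicit Arguments.
Unset Strict Implicit.
Unset Printing Implicit Defensive.

Local Open Scope group_scope.

(** Write g_i for the lower central series of G and G_i for that of nu(G).
    Two facts carry the proof.

    The first is Rocco's description of G_{i+1}: it is generated by g_{i+1},
    its copy and the commutators [g_i, G^phi], [G, g_i^phi] ([gamma_nu]).
    The subgroup R_i generated by these is normal by the relations of nu(G),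
    and R_{i+1} contains every commutator of a generator of R_i with a
    letter. Only the generators [x, y^phi] need thought there: the relations
    force [[x, y^phi], z] = [[x, y^phi], z^phi] = [[x, y], z^phi]. In
    particular nu(G) is nilpotent as soon as G is.

    The second is a congruence: for u in G_i and any v, the element [u, [u,
    v]] lies in G_{2i+1}, so [u^p, v] and [u, v]^p agree modulo G_{2i+1}. As
    i >= m >= s, that is inside G_{i+s+1}; similarly G_{i+1} is abelian
    modulo G_{2i+2}, so there the p-th power map is a homomorphism.
    Evaluating it on Rocco's generators, and using g_{i+s} = g_i^p, shows
    that p-th powers of elements of G_{i+1} lie in G_{i+s+1}
    ([gamma_nu_expg]). For i > m the error term G_{2i+1} even lies in
    G_{i+s+2}, so the same congruence gives G_{i+s+1} <= G_{i+1}^p modulo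
    G_{i+s+2}, and nilpotency lets a downward induction on i
    ([gamma_descent]) remove the error ([gamma_nu_sub_power]). This is (a).

    For the exponents let p^e = exp(g_m). The same downward induction,
    inside G, shows that g_{m+es} is generated by the p^e-th powers of the
    elements of g_m ([gamma_iter_power]), hence is trivial, and then so is
    G_{m+es+1}. But the p^e-th power of an element of G_{m+1} lies in
    G_{m+es+1}, since each p-th power climbs s steps. *)

(** * Subgroups of an arbitrary group, as sets *)

Section SubgroupSets.
Variable N : groupType.
Local Open Scope classical_set_scope.
Implicit Types (A B H K M : set N) (x y z g : N).

Lemma is_subgroup1 H : is_subgroup H -> H 1.
Proof. by case. Qed.

Lemma is_subgroupV H x : is_subgroup H -> H x -> H x^-1.
Proof. by case=> H1 HV Hx; rewrite -[x^-1]mul1g; apply: HV. Qed.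

Lemma is_subgroupM H x y : is_subgroup H -> H x -> H y -> H (x * y).
Proof.
move=> sH Hx Hy; rewrite -[y]invgK; apply: (proj2 sH) => //.
exact: is_subgroupV.
Qed.

Lemma is_subgroupX H x n : is_subgroup H -> H x -> H (x ^+ n).
Proof.
move=> sH Hx; elim: n => [|n IHn]; first exact: is_subgroup1.
by rewrite expgS; apply: is_subgroupM.
Qed.

Lemma is_subgroupP H :
    H 1 -> (forall x y, H x -> H y -> H (x * y)) ->
    (forall x, H x -> H x^-1) -> is_subgroup H.
Proof. by move=> H1 HM HV; split=> // x y Hx Hy; apply/HM/HV. Qed.

Lemma is_subgroup_gen A : is_subgroup (subgroup_gen A).
Proof.
split=> [B [[] ] //|x y genx geny B [sB AB]].
by apply: (proj2 sB); [apply: genx | apply: geny].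
Qed.

Lemma sub_subgroup_gen A : A `<=` subgroup_gen A.
Proof. exact: sub_gen_smallest. Qed.

Lemma subgroup_gen_sub A H : is_subgroup H -> A `<=` H -> subgroup_gen A `<=` H.
Proof. exact: smallest_sub. Qed.

Definition is_normal H := is_subgroup H /\ forall x g, H x -> H (x ^ g).

Lemma is_subgroup_conj H g : is_subgroup H -> is_subgroup [set x | H (x ^ g)].
Proof.
move=> sH; apply: is_subgroupP => /= [|x y Hx Hy|x Hx].
- by rewrite conj1g; apply: (is_subgroup1 sH).
- by rewrite conjMg; apply: (is_subgroupM sH).
by rewrite conjVg; apply: (is_subgroupV sH).
Qed.

Lemma is_normal_gen A :
  (forall a g, A a -> A (a ^ g)) -> is_normal (subgroup_gen A).
Proof.
move=> AJ; have sA := is_subgroup_gen A; split=> // x g; move: x.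
apply: (subgroup_gen_sub (is_subgroup_conj g sA)).
by move=> a Aa /=; exact: sub_subgroup_gen (AJ _ _ Aa).
Qed.

Lemma is_normalT : is_normal (@setT N).
Proof. by []. Qed.

Lemma is_normal_commg K x g : is_normal K -> K x -> K [~ x, g].
Proof.
case=> sK KJ Kx; rewrite commgEl.
by apply: (is_subgroupM sK); [apply: (is_subgroupV sK) | apply: KJ].
Qed.

Lemma commutator_subP A B x y : A x -> B y -> commutator_sub A B [~ x, y].
Proof. by move=> Ax By; apply: sub_subgroup_gen; exists x, y. Qed.

Lemma power_subP n H x : H x -> power_sub n H (x ^+ n).
Proof. by move=> Hx; apply: sub_subgroup_gen; exists x. Qed.

Lemma power_subS n H K : H `<=` K -> power_sub n H `<=` power_sub n K.
Proof.
move=> HK; apply: subgroup_gen_sub; first exact: is_subgroup_gen.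
by move=> _ [x Hx ->]; exact: power_subP (HK _ Hx).
Qed.

Lemma is_normal_commutator A B :
  is_normal A -> is_normal B -> is_normal (commutator_sub A B).
Proof.
move=> [_ AJ] [_ BJ]; apply: is_normal_gen => _ g [x [y [Ax By ->]]].
by exists (x ^ g), (y ^ g); rewrite conjRg; split; [apply: AJ | apply: BJ |].
Qed.

Lemma is_normal_power n H : is_normal H -> is_normal (power_sub n H).
Proof.
move=> [_ HJ]; apply: is_normal_gen => _ g [x Hx ->].
by exists (x ^ g); [apply: HJ | rewrite conjXg].
Qed.

Lemma commg_mull x y z : [~ x * y, z] = [~ x, z] ^ y * [~ y, z].
Proof. by rewrite !commgEl !conjgE !invMg !mulgA !(mulgK, mulgVK). Qed.

(** By [commg_mull], commuting with y modulo a normal subgroup is a condition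
    that can be tested on generators. *)
Lemma is_subgroup_commg K y : is_normal K -> is_subgroup [set x | K [~ x, y]].
Proof.
case=> sK KJ.
apply: is_subgroupP => /= [|x z Kx Kz|x Kx].
- by rewrite comm1g; apply: (is_subgroup1 sK).
- by rewrite commg_mull; apply: (is_subgroupM sK) => //; apply: KJ.
have -> : [~ x^-1, y] = ([~ x, y] ^ x^-1)^-1.
  by apply: (mulgI ([~ x, y] ^ x^-1)); rewrite mulgV -commg_mull mulgV comm1g.
by apply: (is_subgroupV sK); apply: KJ.
Qed.

Lemma commg_gen K A B : is_normal K ->
    (forall a b, A a -> B b -> K [~ a, b]) ->
  forall x y, subgroup_gen A x -> subgroup_gen B y -> K [~ x, y].
Proof.
move=> nK KAB x y Ax By; have [sK _] := nK.
apply: (subgroup_gen_sub (is_subgroup_commg y nK)) Ax => a Aa /=.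
rewrite -invgR; apply: (is_subgroupV sK).
apply: (subgroup_gen_sub (is_subgroup_commg a nK)) By => b Bb /=.
by rewrite -invgR; apply: (is_subgroupV sK); apply: KAB.
Qed.

Lemma expgMn_mod K x y n : is_normal K -> K [~ x, y] ->
  exists2 k, K k & (x * y) ^+ n = x ^+ n * y ^+ n * k.
Proof.
move=> nK Kxy; have [sK KJ] := nK.
elim: n => [|n [k Kk IHn]]; first by exists 1; [case: sK | rewrite !mulg1].
exists ([~ y ^+ n, x] ^ y * k ^ (x * y)).
  apply: (is_subgroupM sK) (KJ _ _ Kk); apply: KJ.
  apply: (is_subgroupX n (is_subgroup_commg x nK)) => /=.
  by rewrite -invgR; apply: (is_subgroupV sK).
rewrite expgSr IHn [x ^+ n.+1]expgSr [y ^+ n.+1]expgSr.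
by rewrite commgEl !conjgE !invMg !mulgA !(mulgK, mulgVK).
Qed.

(** Both conditions compare (x^n)^y = (x [x, y])^n with x^n, and modulo K the
    factors x and [x, y] commute. *)
Lemma commXg_normal K x y n : is_normal K -> K [~ x, [~ x, y]] ->
  K [~ x ^+ n, y] <-> K ([~ x, y] ^+ n).
Proof.
move=> nK /(expgMn_mod n nK)[k Kk Exy]; have [sK _] := nK.
have -> : [~ x ^+ n, y] = [~ x, y] ^+ n * k.
  by rewrite commgEl conjXg -[x ^ y](mulKVg x) -commgEl Exy !mulgA mulVg mul1g.
split=> Kxy; last exact: (is_subgroupM sK).
rewrite -[_ ^+ n](mulgK k); apply: (is_subgroupM sK) => //.
exact: (is_subgroupV sK).
Qed.

(** Modulo K the subgroup generated by A is abelian, so there the n-th power map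
    is a homomorphism and may be evaluated on generators. *)
Lemma expg_gen A K M n : is_normal K -> is_subgroup M -> K `<=` M ->
    (forall x y, subgroup_gen A x -> subgroup_gen A y -> K [~ x, y]) ->
    (forall a, A a -> M (a ^+ n)) ->
  forall x, subgroup_gen A x -> M (x ^+ n).
Proof.
move=> nK sM KM abA AM x Ax; have sA := is_subgroup_gen A.
suffices sub : subgroup_gen A `<=` [set x | subgroup_gen A x /\ M (x ^+ n)].
  by case: (sub x Ax).
apply: subgroup_gen_sub => [|a Aa]; last first.
  by split; [apply: sub_subgroup_gen | apply: AM].
apply: is_subgroupP => /= [|{Ax}x y [Ax Mx] [Ay My]|{Ax}x [Ax Mx]].
- rewrite expg1n; split; first exact: (is_subgroup1 sA).
  exact: (is_subgroup1 sM).
- split; first exact: (is_subgroupM sA).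
  have [k Kk ->] := expgMn_mod n nK (abA _ _ Ax Ay).
  by apply: (is_subgroupM sM); [apply: (is_subgroupM sM) | apply: KM].
by rewrite expVgn; split; [exact: (is_subgroupV sA) | exact: (is_subgroupV sM)].
Qed.

Lemma exponent_set_dvd H e : 0 < e -> (forall x, H x -> x ^+ e = 1) ->
  exponent_set H %| e.
Proof.
move=> e_gt0 He; rewrite /exponent_set; case: pselect => [exP|]; last first.
  by case; exists e; apply/asboolP.
case: ex_minnP => n /asboolP[n_gt0 Hn] n_min.
rewrite /dvdn -leqn0 leqNgt; apply/negP => r_gt0.
suffices: n <= e %% n by rewrite leqNgt ltn_pmod.
apply/n_min/asboolP; split=> // x Hx; have := He x Hx.
by rewrite {1}(divn_eq e n) expgnDr mulnC expgnA Hn // expg1n mul1g.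
Qed.

(** * The lower central series *)

Local Notation gamma := (gamma_series N).

Lemma gamma_seriesS i : 0 < i -> gamma i.+1 = commutator_sub (gamma i) setT.
Proof. by case: i. Qed.

Lemma is_normal_gamma i : is_normal (gamma i).
Proof.
case: i => [|i]; first exact: is_normalT.
elim: i => [|i IHi]; first exact: is_normalT.
by rewrite gamma_seriesS //; apply: is_normal_commutator.
Qed.

Lemma gamma_commT i x y : 0 < i -> gamma i x -> gamma i.+1 [~ x, y].
Proof.
by move=> i_gt0 Gx; rewrite gamma_seriesS //; apply: commutator_subP.
Qed.

Lemma gamma_anti i j : i <= j -> gamma j `<=` gamma i.
Proof.
move=> /subnK<-; elim: (j - i) => // n IHn; apply: subset_trans IHn.
rewrite addSn; case: (n + i) => [|k] //; rewrite gamma_seriesS //.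
have nG := is_normal_gamma k.+1.
apply: subgroup_gen_sub => [|_ [x [y [Gx _ ->]]]]; first by case: nG.
exact: is_normal_commg.
Qed.

(** Induction on j, with i varying: the Hall-Witt identity trades
    [x, [y, z]] for commutators [[x, y], z] and [[x, z], y], for which j is
    smaller.  (Here y is in the j-th term and z is arbitrary.) *)
Lemma gamma_comm i j x y : 0 < i -> 0 < j ->
  gamma i x -> gamma j y -> gamma (i + j) [~ x, y].
Proof.
move=> i_gt0; elim: j => // j IHj in i x y i_gt0 *.
have [-> _ Gx _ | j_gt0 _ Gx Gy] := posnP j.
  by rewrite addn1; apply: gamma_commT.
have nK := is_normal_gamma (i + j.+1); have [sK KJ] := nK.
rewrite -invgR; apply: (is_subgroupV sK).
rewrite gamma_seriesS // in Gy.
apply: (subgroup_gen_sub (is_subgroup_commg x nK)) Gy.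
move=> _ [{}y [z [Gy _ ->]]] /=.
(* The Hall-Witt identity, for a product that starts with [y, z, x]. *)
have -> : [~ y, z, x]
    = (([~ z^-1, x^-1, y] ^ x * [~ x, y^-1, z^-1] ^ y) ^ z)^-1.
  rewrite !commgEl !conjgE !invMg !invgK !mulgA.
  by rewrite !(mulgK, mulgVK).
have [[sGi _] [sGj _]] := (is_normal_gamma i, is_normal_gamma j).
apply: (is_subgroupV sK); apply: (KJ); apply: (is_subgroupM sK); apply: (KJ).
  rewrite -addSnnS; apply: IHj => //.
  rewrite -invgR; apply: (is_subgroupV (proj1 (is_normal_gamma i.+1))).
  by apply: gamma_commT => //; apply: (is_subgroupV sGi).
rewrite addnS; apply: gamma_commT; first by rewrite addn_gt0 i_gt0.
by apply: IHj => //; apply: (is_subgroupV sGj).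
Qed.

(** * Power laws along the lower central series *)

(** Downward induction starting at the end of a nilpotent series: an
    inclusion of the (i+t)-th term in a decreasing family may be proved
    modulo the next term. *)
Lemma gamma_descent (c m t : nat) (H : nat -> set N) :
    gamma c `<=` [set 1] -> (forall i, is_subgroup (H i)) ->
    (forall i, H i.+1 `<=` H i) ->
    (forall i, m <= i -> gamma (i.+1 + t) `<=` H i -> gamma (i + t) `<=` H i) ->
  forall i, m <= i -> gamma (i + t) `<=` H i.
Proof.
move=> Gc1 sH Hanti step i mi.
have [d le_c] : exists d, c <= i + t + d by exists c; rewrite leq_addl.
elim: d i mi le_c => [|d IHd] i mi le_c.
  rewrite addn0 in le_c => x /(gamma_anti le_c) /Gc1 ->.
  by case: (sH i).
apply: step => //; apply: subset_trans (Hanti i); apply: IHd.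
  exact: leqW.
by rewrite !addSn -addnS.
Qed.

Section PowerLaw.
Variables p m s c : nat.
Hypotheses (m_gt0 : 0 < m) (s_gt0 : 0 < s) (le_s_m : s <= m).
Hypothesis gamma_power :
  forall i, m <= i -> gamma (i + s) = power_sub p (gamma i).
Hypothesis gamma_c : gamma c `<=` [set 1].

Lemma expg_gamma k i x :
  m <= i -> gamma i x -> gamma (i + k * s) (x ^+ (p ^ k)).
Proof.
move=> mi Gx; elim: k => [|k IHk]; first by rewrite addn0 expn0 expg1.
rewrite mulSnr addnA gamma_power ?(leq_trans mi) ?leq_addr //.
by rewrite expnSr expgnA; apply: power_subP.
Qed.

(** The hypothesis only describes an iterate: p-th powers of products of p-th
    powers, and so on.  But the (i+ks)-th term is abelian modulo the
    (2i+2ks)-th, which for k > 0 lies beyond the (i+(k+1)s)-th; so the last p-th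
    power may be taken on generators, which are p^k-th powers by induction on k,
    and the error is left to the downward induction. *)
Lemma gamma_iter_power k i :
  m <= i -> gamma (i + k * s) `<=` power_sub (p ^ k) (gamma i).
Proof.
elim: k i => [|k IHk] i.
  by move=> _ x Gx; rewrite -[x]expg1; apply: power_subP; rewrite addn0 in Gx.
have [-> mi|k_gt0] := posnP k; first by rewrite mul1n gamma_power.
move: i; apply: (gamma_descent gamma_c) => [i|i|i mi sub].
- exact: is_subgroup_gen.
- exact: power_subS (gamma_anti (leqnSn i)).
have sM : is_subgroup (power_sub (p ^ k.+1) (gamma i)).
  exact: is_subgroup_gen.
have mik : m <= i + k * s by apply: leq_trans mi _; apply: leq_addr.
rewrite mulSnr addnA gamma_power //.
apply: subgroup_gen_sub => // _ [x /(IHk i mi) Gx ->].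
move: x Gx; apply: (expg_gen (is_normal_gamma (i.+1 + k.+1 * s)) sM sub).
  have sG : power_sub (p ^ k) (gamma i) `<=` gamma (i + k * s).
    apply: subgroup_gen_sub => [|_ [x Gx ->]]; last exact: expg_gamma.
    by case: (is_normal_gamma (i + k * s)).
  move=> x y /sG Gx /sG Gy.
  have ik_gt0 : 0 < i + k * s by apply: leq_trans mik.
  apply: gamma_anti (gamma_comm ik_gt0 ik_gt0 Gx Gy).
  by have : 0 < k * s; [rewrite muln_gt0 k_gt0 | lia].
move=> _ [x Gx ->]; rewrite -expgnA -expnSr; exact: power_subP.
Qed.

End PowerLaw.
End SubgroupSets.

(** * Generators of the lower central series of nu(G) *)

Section Morphisms.
Variables (G N : groupType) (f : UMagmaMorphism.type G N).
Local Open Scope classical_set_scope.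

Lemma is_subgroup_preim (H : set N) : is_subgroup H -> is_subgroup (f @^-1` H).
Proof.
move=> sH; split=> [|x y Hx Hy] /=; first by rewrite gmulf1; case: sH.
by rewrite gmulfF; apply: (proj2 sH).
Qed.

Lemma gamma_morph i x : gamma_series G i x -> gamma_series N i (f x).
Proof.
case: i => [|i] //; elim: i x => [|i IHi] // x; move: x.
have [sG _] := is_normal_gamma N i.+2.
apply: (subgroup_gen_sub (is_subgroup_preim sG)) => _ [x [y [Gx _ ->]]] /=.
by rewrite gmulfR; apply: gamma_commT => //; apply: IHi.
Qed.
End Morphisms.

Section NuGenerators.
Variable gT : groupType.
Local Open Scope classical_set_scope.
Local Notation a := (@nu_in gT).
Local Notation b := (@nu_phi gT).
Local Notation gamma := (gamma_series gT).
Local Notation Gamma := (gamma_series (nu gT)).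

Lemma nu_in_monoid_morphism : monoid_morphism a.
Proof.
split=> [|x y]; last exact: nu_inM.
by apply: (mulIg (a 1)); rewrite -nu_inM !mul1g.
Qed.

Lemma nu_phi_monoid_morphism : monoid_morphism b.
Proof.
split=> [|x y]; last exact: nu_phiM.
by apply: (mulIg (b 1)); rewrite -nu_phiM !mul1g.
Qed.

HB.instance Definition _ :=
  isUMagmaMorphism.Build gT (nu gT) (@nu_in gT) nu_in_monoid_morphism.
HB.instance Definition _ :=
  isUMagmaMorphism.Build gT (nu gT) (@nu_phi gT) nu_phi_monoid_morphism.

Lemma nu_ind (P : set (nu gT)) :
    P 1 -> (forall u v, P u -> P v -> P (u * v)) ->
    (forall g, P (a g)) -> (forall g, P (b g)) ->
  forall u, P u.
Proof.
move=> P1 PM Pa Pb; elim/quotW; elim=> [|l u IHu]; first exact: P1.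
by rewrite -cat1s nu_ME; apply: PM IHu; case: l.
Qed.

Lemma nu_conj_in x y g : [~ a x, b y] ^ a g = [~ a (x ^ g), b (y ^ g)].
Proof. exact: nu_in_rel. Qed.

Lemma nu_conj_phi x y g : [~ a x, b y] ^ b g = [~ a (x ^ g), b (y ^ g)].
Proof. by rewrite nu_phi_rel. Qed.

(** Any [x, d^phi] has the same conjugate by y^phi as by y; for d^y = c this
    reads [x^(y^phi), c^phi] = [x^y, c^phi]. Write both conjugates as x
    times a commutator and expand: the factors coming from x agree since [x,
    y^phi] and [x, y] act in the same way on [G, G^phi]. Thus a commutator
    of a generator [x, y^phi] with a letter is again a commutator of an
    element of G with one of G^phi. *)
Lemma nu_comm3_phi x y g : [~ [~ a x, b y], b g] = [~ a [~ x, y], b g].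
Proof.
have conj_swap z h c : [~ a z ^ b h, b c] = [~ a z ^ a h, b c].
  rewrite -gmulfJ -[c](conjgKV h) -nu_conj_phi conjRg /=; congr [~ _, _].
  by rewrite -gmulfJ.
have := conj_swap x y g.
rewrite -[a x ^ b y](mulKVg (a x)) -[a x ^ a y](mulKVg (a x)) -!commgEl.
rewrite (commg_mull (a x) [~ a x, b y]) (commg_mull (a x) [~ a x, a y]).
rewrite -gmulfR /= nu_conj_in.
have -> : [~ a x, b g] ^ [~ a x, b y] = [~ a (x ^ [~ x, y]), b (g ^ [~ x, y])].
  have -> : [~ a x, b y] = a x^-1 * (b y^-1 * (a x * b y)).
    by rewrite !gmulfV commgEl conjgE.
  rewrite !conjgM nu_conj_in nu_conj_phi nu_conj_in nu_conj_phi -!conjgM.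
  by rewrite commgEl conjgE.
exact: mulgI.
Qed.

Lemma nu_comm3_in x y g : [~ [~ a x, b y], a g] = [~ a [~ x, y], b g].
Proof. by rewrite -nu_comm3_phi !(commgEl [~ _, _]) nu_conj_in nu_conj_phi. Qed.

(** The generators of the (i+1)-st term.  For i = 0 they include both copies of
    G, so that the description also covers the whole group.  Two families of
    commutators keep the description symmetric in the two copies. *)
Inductive nu_gen i : nu gT -> Prop :=
| nu_gen_in x of gamma i.+1 x : nu_gen i (a x)
| nu_gen_phi x of gamma i.+1 x : nu_gen i (b x)
| nu_gen_comml x y of gamma i x : nu_gen i [~ a x, b y]
| nu_gen_commr x y of gamma i y : nu_gen i [~ a x, b y].

(** Conjugation of x by the other copy is the only case where a generator does
    not go to a generator: x^(g^phi) = x [x, g^phi], and symmetrically. *)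
Lemma is_normal_nu_gen i : is_normal (subgroup_gen (nu_gen i)).
Proof.
have sR := is_subgroup_gen (nu_gen i); split=> // x g; move: g x.
have gammaJ j x g : gamma j x -> gamma j (x ^ g).
  by case: (is_normal_gamma gT j) => _; apply.
have gammaW x : gamma i.+1 x -> gamma i x by apply: gamma_anti.
apply: nu_ind => [x|u v Ru Rv x Rx|g|g].
- by rewrite conjg1.
- by rewrite conjgM; exact: Rv (Ru _ Rx).
- apply: (subgroup_gen_sub (is_subgroup_conj (a g) sR)) => _ [] x.
  + move=> Gx /=; rewrite -gmulfJ.
    by apply: sub_subgroup_gen; apply: nu_gen_in; apply: gammaJ.
  + move=> Gx /=; rewrite -[_ ^ _](mulKVg (b x)) -commgEl -invgR.
    apply: (is_subgroupM sR).
      by apply: sub_subgroup_gen; apply: nu_gen_phi.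
    apply: (is_subgroupV sR); apply: sub_subgroup_gen.
    by apply: nu_gen_commr; apply: gammaW.
  + move=> y Gx /=; rewrite nu_conj_in.
    by apply: sub_subgroup_gen; apply: nu_gen_comml; apply: gammaJ.
  + move=> y Gx /=; rewrite nu_conj_in.
    by apply: sub_subgroup_gen; apply: nu_gen_commr; apply: gammaJ.
apply: (subgroup_gen_sub (is_subgroup_conj (b g) sR)) => _ [] x.
- move=> Gx /=; rewrite -[_ ^ _](mulKVg (a x)) -commgEl.
  apply: (is_subgroupM sR).
    by apply: sub_subgroup_gen; apply: nu_gen_in.
  by apply: sub_subgroup_gen; apply: nu_gen_comml; apply: gammaW.
- move=> Gx /=; rewrite -gmulfJ.
  by apply: sub_subgroup_gen; apply: nu_gen_phi; apply: gammaJ.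
- move=> y Gx /=; rewrite nu_conj_phi.
  by apply: sub_subgroup_gen; apply: nu_gen_comml; apply: gammaJ.
move=> y Gx /=; rewrite nu_conj_phi.
by apply: sub_subgroup_gen; apply: nu_gen_commr; apply: gammaJ.
Qed.

Inductive nu_letter : nu gT -> Prop :=
| nu_letter_in g : nu_letter (a g)
| nu_letter_phi g : nu_letter (b g).

Lemma subgroup_gen_letter u : subgroup_gen nu_letter u.
Proof.
have sL := is_subgroup_gen nu_letter.
apply: nu_ind u => [|u v Lu Lv|g|g]; first exact: (is_subgroup1 sL).
- exact: (is_subgroupM sL).
- exact: sub_subgroup_gen (nu_letter_in g).
exact: sub_subgroup_gen (nu_letter_phi g).
Qed.

Lemma nu_gen_comm i u v : nu_gen i u -> nu_letter v ->
  subgroup_gen (nu_gen i.+1) [~ u, v].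
Proof.
have sR := is_subgroup_gen (nu_gen i.+1).
have in_gen z : nu_gen i.+1 z -> subgroup_gen (nu_gen i.+1) z.
  exact: sub_subgroup_gen.
have comml x y : gamma i x -> gamma i.+1 [~ x, y].
  by case: i {sR in_gen} => // i; apply: gamma_commT.
have commr x y : gamma i y -> gamma i.+1 [~ x, y].
  move=> Gy; rewrite -invgR.
  apply: (is_subgroupV (proj1 (is_normal_gamma gT i.+1))); exact: comml.
case=> x => [Gx|Gx|y Gx|y Gy]; case=> g.
- rewrite -gmulfR; apply: in_gen; apply: nu_gen_in; exact: gamma_commT.
- by apply: in_gen; apply: nu_gen_comml.
- rewrite -invgR; apply: (is_subgroupV sR); apply: in_gen; exact: nu_gen_commr.
- rewrite -gmulfR; apply: in_gen; apply: nu_gen_phi; exact: gamma_commT.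
- rewrite nu_comm3_in; apply: in_gen; apply: nu_gen_comml; exact: comml.
- rewrite nu_comm3_phi; apply: in_gen; apply: nu_gen_comml; exact: comml.
- rewrite nu_comm3_in; apply: in_gen; apply: nu_gen_comml; exact: commr.
rewrite nu_comm3_phi; apply: in_gen; apply: nu_gen_comml; exact: commr.
Qed.

(** The non-obvious inclusion says that the generators of one level become
    central modulo the next; this can be checked against the letters of
    nu(G). *)
Lemma gamma_nu i : Gamma i.+1 = subgroup_gen (nu_gen i).
Proof.
apply/seteqP; split; last first.
  have nG := is_normal_gamma (nu gT) i.+1; have [sG _] := nG.
  apply: subgroup_gen_sub => // _ [] x; try by apply: gamma_morph.
    case: i {nG sG} => // i y Gx; apply: gamma_commT => //; exact: gamma_morph.
  case: i {nG} sG => // i sG y Gy; rewrite -invgR; apply: (is_subgroupV sG).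
  by apply: gamma_commT => //; apply: gamma_morph.
elim: i => [|i IHi].
  move=> u _; have sR := is_subgroup_gen (nu_gen 0).
  apply: (subgroup_gen_sub sR) (subgroup_gen_letter u) => _ [] g.
    by apply: sub_subgroup_gen; apply: nu_gen_in.
  by apply: sub_subgroup_gen; apply: nu_gen_phi.
rewrite gamma_seriesS //.
apply: subgroup_gen_sub => [|_ [u [v [/IHi Gu _ ->]]]].
  exact: is_subgroup_gen.
apply: (commg_gen (is_normal_nu_gen i.+1)) Gu (subgroup_gen_letter v).
exact: nu_gen_comm.
Qed.

Lemma gamma_nu_trivial i : gamma i `<=` [set 1] -> Gamma i.+1 `<=` [set 1].
Proof.
have s1 : is_subgroup [set 1 : nu gT].
  by apply: is_subgroupP => /= [|u v -> ->|u ->]; rewrite ?mulg1 ?invg1.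
move=> Gi1; rewrite gamma_nu; apply: subgroup_gen_sub => // _ [] x /=.
- by move=> /(gamma_anti (leqnSn i))/Gi1 ->; rewrite gmulf1.
- by move=> /(gamma_anti (leqnSn i))/Gi1 ->; rewrite gmulf1.
- by move=> y /Gi1 ->; rewrite gmulf1 comm1g.
by move=> y /Gi1 ->; rewrite gmulf1 commg1.
Qed.

(** * Transfer of the power law to nu(G) *)

Section PowerLaw.
Variables p m s c : nat.
Hypotheses (m_gt0 : 0 < m) (s_gt0 : 0 < s) (le_s_m : s <= m).
Hypothesis gamma_power :
  forall i, m <= i -> gamma (i + s) = power_sub p (gamma i).

(** The p-th power map is a homomorphism on the (i+1)-st term modulo the
    (i+s+1)-st, so generators suffice; for [x, y^phi] compare with
    [x^p, y^phi], where x^p lies in the (i+s)-th term of G. *)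
Lemma gamma_nu_expg i u :
  m <= i -> Gamma i.+1 u -> Gamma (i + s).+1 (u ^+ p).
Proof.
move=> mi; have nK := is_normal_gamma (nu gT) (i + s).+1; have [sK _] := nK.
have i_gt0 : 0 < i by apply: leq_trans mi.
have gammaP j x : m <= j -> gamma j x -> gamma (j + s) (x ^+ p).
  by move=> mj Gx; rewrite gamma_power //; apply: power_subP.
have in_Gamma z : nu_gen (i + s) z -> Gamma (i + s).+1 z.
  by rewrite gamma_nu; exact: sub_subgroup_gen.
(* The error term [f x, [f x, v]] has weight 2i + 1, and i >= s. *)
have base (f : UMagmaMorphism.type gT (nu gT)) x v : gamma i x ->
    Gamma (i + s).+1 [~ f (x ^+ p), v] -> Gamma (i + s).+1 ([~ f x, v] ^+ p).
  move=> Gx; have Gfx := gamma_morph f Gx.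
  rewrite gmulfXn (commXg_normal p nK) //.
  apply: gamma_anti (gamma_comm i_gt0 _ Gfx (gamma_commT v i_gt0 Gfx)) => //.
  by lia.
rewrite gamma_nu; move: u; apply: (expg_gen nK sK) => //.
  rewrite -gamma_nu => u v Gu Gv.
  by apply: gamma_anti (gamma_comm _ _ Gu Gv) => //; lia.
move=> _ [] x.
- move=> Gx; rewrite -gmulfXn; apply: in_Gamma; apply: nu_gen_in.
  by rewrite -addSn; apply: gammaP => //; apply: leqW.
- move=> Gx; rewrite -gmulfXn; apply: in_Gamma; apply: nu_gen_phi.
  by rewrite -addSn; apply: gammaP => //; apply: leqW.
- move=> y Gx; apply: base => //; apply: in_Gamma; apply: nu_gen_comml.
  exact: gammaP.
move=> y Gy; rewrite -invgR expVgn; apply: (is_subgroupV sK).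
apply: base => //; rewrite -invgR; apply: (is_subgroupV sK); apply: in_Gamma.
by apply: nu_gen_commr; apply: gammaP.
Qed.

Lemma gamma_nu_expg_iter k u :
  Gamma m.+1 u -> Gamma (m + k * s).+1 (u ^+ (p ^ k)).
Proof.
move=> Gu; elim: k => [|k IHk]; first by rewrite addn0 expn0 expg1.
rewrite mulSnr addnA expnSr expgnA; apply: gamma_nu_expg => //.
exact: leq_addr.
Qed.

Hypothesis gamma_c : gamma c `<=` [set 1].

(** Here i > m >= s makes the error [x, [x, v]], of weight 2i + 1, fall into the
    (i+s+2)-nd term, which the downward induction has already placed among the
    products of p-th powers. *)
Lemma gamma_nu_sub_power i :
  m < i -> Gamma (i + s).+1 `<=` power_sub p (Gamma i.+1).
Proof.
rewrite -addnS; move: i.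
apply: (gamma_descent (gamma_nu_trivial gamma_c)) => [i|i|i mi sub].
- exact: is_subgroup_gen.
- exact: power_subS (gamma_anti (leqnSn i.+1)).
have nM : is_normal (power_sub p (Gamma i.+1)).
  by apply: is_normal_power; apply: is_normal_gamma.
have i_gt0 : 0 < i by apply: leq_trans mi.
have [sM _] := nM.
have letter (f : UMagmaMorphism.type gT (nu gT)) x :
    gamma (i + s).+1 x -> power_sub p (Gamma i.+1) (f x).
  rewrite -addSn gamma_power ?(leqW (ltnW mi)) //; move: x.
  apply: (subgroup_gen_sub (is_subgroup_preim f sM)) => _ [x Gx ->] /=.
  by rewrite gmulfXn; apply: power_subP; apply: gamma_morph.
have base (f : UMagmaMorphism.type gT (nu gT)) x v :
    gamma (i + s) x -> power_sub p (Gamma i.+1) [~ f x, v].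
  rewrite gamma_power ?(ltnW mi) //; move: x.
  apply: (subgroup_gen_sub (is_subgroup_preim f (is_subgroup_commg v nM))).
  move=> _ [x Gx ->] /=; have Gfx := gamma_morph f Gx.
  rewrite gmulfXn (commXg_normal p nM).
    by apply: power_subP; apply: gamma_commT.
  apply: sub.
  apply: gamma_anti (gamma_comm i_gt0 _ Gfx (gamma_commT v i_gt0 Gfx)) => //.
  by lia.
rewrite addnS gamma_nu; apply: subgroup_gen_sub => // _ [] x.
- exact: letter.
- exact: letter.
- by move=> y; apply: base.
by move=> y Gy; rewrite -invgR; apply: (is_subgroupV sM); apply: base.
Qed.

End PowerLaw.
End NuGenerators.

(** * Comparison with subgroups of finite groups *)

Section FiniteGroups.
Variable gT : finGroupType.
Local Open Scope classical_set_scope.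

Lemma subgroup_gen_fin (A : {set gT}) :
  subgroup_gen [set` A] = [set` <<A>>].
Proof.
apply/seteqP; split.
  apply: subgroup_gen_sub => [|x /= Ax]; last exact: mem_gen.
  by split=> [|x y /= Ax Ay]; [apply: group1 | rewrite groupM ?groupV].
have sA := is_subgroup_gen [set` A].
have gA : group_set [set x : gT | `[< subgroup_gen [set` A] x >]]%SET.
  apply/group_setP; split=> [|x y]; first by rewrite !inE; case: sA.
  by rewrite !inE; apply: (is_subgroupM sA).
move=> x; have: <<A>> \subset Group gA.
  rewrite gen_subG; apply/fintype.subsetP => y Ay; rewrite !inE.
  exact: sub_subgroup_gen.
by move=> /fintype.subsetP sub Ax; have := sub x Ax; rewrite !inE.
Qed.

Lemma power_sub_fin n (A : {set gT}) :
  power_sub n [set` A] = [set` power_subgroup n A].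
Proof.
rewrite -subgroup_gen_fin; congr subgroup_gen; apply/seteqP; split=> x /=.
  by case=> y Ay ->; apply: imset_f.
by case/imsetP=> y Ay ->; exists y.
Qed.

Lemma gamma_series_fin i : gamma_series gT i = [set` 'L_i([set: gT]%SET)].
Proof.
case: i => [|i]; first by apply/seteqP; split=> x; rewrite //= inE.
elim: i => [|i IHi]; first by apply/seteqP; split=> x; rewrite //= inE.
rewrite gamma_seriesS // IHi lcnSn -subgroup_gen_fin.
congr subgroup_gen; apply/seteqP; split=> z /=.
  by case=> x [y [Gx _ ->]]; apply: imset2_f; rewrite ?inE.
by case/imset2P=> x y Gx _ ->; exists x, y.
Qed.

End FiniteGroups.

Theorem theorem1p1 (p : nat) (gT : finGroupType) (m s : nat)
    (p_prime : prime p) (pG : p.-group [set: gT])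
    (m_gt0 : (0 < m)%N) (s_gt0 : (0 < s)%N) (le_s_m : (s <= m)%N)
    (gammaG : forall i : nat, (m <= i)%N ->
       'L_(i + s)([set: gT]) = power_subgroup p 'L_i([set: gT])) :
  [/\ forall i : nat, (m < i)%N ->
        gamma_series (nu gT) (i + s + 1) =
          power_sub p (gamma_series (nu gT) (i + 1)),
      odd p ->
        (exponent_set (gamma_series (nu gT) (m + 1))
           %| exponent 'L_m([set: gT]))%N
    & p = 2 -> powerful p 'L_m([set: gT]) ->
        (exponent_set (gamma_series (nu gT) (m + 1))
           %| exponent 'L_m([set: gT]))%N].
Proof.
have law i : m <= i ->
    gamma_series gT (i + s) = power_sub p (gamma_series gT i).
  by move=> mi; rewrite !gamma_series_fin gammaG // -power_sub_fin.
have [c gamma_c] : exists c, (gamma_series gT c `<=` [set 1])%classic.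
  have /lcnP[c Lc] := pgroup_nil pG; exists c.+1.
  by rewrite gamma_series_fin Lc => x /= /set1P.
have dvd_exp : exponent_set (gamma_series (nu gT) (m + 1))
    %| exponent 'L_m([set: gT]).
  apply: exponent_set_dvd; first exact: exponent_gt0.
  have pL : p.-group 'L_m([set: gT]) by apply: pgroupS (lcn_sub _ _) pG.
  have /p_natP[e exp_e] : p.-nat (exponent 'L_m([set: gT])).
    by rewrite pnat_exponent.
  have gamma_e : (gamma_series gT (m + e * s) `<=` [set 1])%classic.
    have sub := gamma_iter_power m_gt0 s_gt0 le_s_m law gamma_c (k := e).
    apply: subset_trans (sub m (leqnn m)) _.
    apply: subgroup_gen_sub => [|_ [x Gx ->] /=].
      by apply: is_subgroupP => /= [|u v -> ->|u ->]; rewrite ?mulg1 ?invg1.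
    rewrite gamma_series_fin /= in Gx.
    by rewrite -exp_e expg_exponent.
  move=> u; rewrite exp_e addn1.
  move=> /(gamma_nu_expg_iter m_gt0 s_gt0 le_s_m law e).
  exact: gamma_nu_trivial.
split=> // i mi; rewrite !addn1; apply/seteqP; split.
  exact: (gamma_nu_sub_power m_gt0 s_gt0 le_s_m law gamma_c).
apply: subgroup_gen_sub => [|_ [u Gu ->]].
  by case: (is_normal_gamma (nu gT) (i + s).+1).
by apply: (gamma_nu_expg m_gt0 s_gt0 le_s_m law) => //; apply: ltnW.
Qed.
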